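(* Let $(\Omega,\mathcal{F})$ be a measurable space, let $E\subseteq\Omega\times\Omega$ be a relation on $\Omega$, and let $\mathcal{G}$ be a subset of $\mathcal{F}$ with $\Omega\in\mathcal{G}$. If the pair $(E,\mathcal{G})$ satisfies strong duality, then the pair $(E,E^{\ast})$ satisfies strong duality.
   Context: For a relation $E\subseteq\Omega\times\Omega$, $E^{\ast}:=\{A\in\mathcal{F}:\forall(\omega,\omega')\in E,\ (\omega\in A\Leftrightarrow\omega'\in A)\}$, a sub-$\sigma$-algebra of $\mathcal{F}$. $\mathcal{P}(\Omega,\mathcal{F})$ is the set of probability measures on $(\Omega,\mathcal{F})$, and $\Pi(\mathbb{P},\mathbb{P}')$ is the set of probability measures on $(\Omega\times\Omega,\mathcal{F}\otimes\mathcal{F})$ with marginals $\mathbb{P}$ and $\mathbb{P}'$. For a relation $E$ and a subset $\mathcal{G}\subseteq\mathcal{F}$ (not necessarily a $\sigma$-algebra), the pair $(E,\mathcal{G})$ satisfies strong duality if $E\in\mathcal{F}\otimes\mathcal{F}$ and, for all $\mathbb{P},\mathbb{P}'\in\mathcal{P}(\Omega,\mathcal{F})$, $$\max_{A\in\mathcal{G}}|\mathbb{P}(A)-\mathbb{P}'(A)|=\min_{\tilde{\mathbb{P}}\in\Pi(\mathbb{P},\mathbb{P}')}(1-\tilde{\mathbb{P}}(E)),$$ where max and min assert that the supremum and infimum are both attained. *)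

(* Defs.v *)
From HB Require Import structures.
From mathcomp Require Import all_boot all_order all_algebra.
From mathcomp Require Import all_classical all_reals all_analysis.

Set Implicit Arguments.
Unset Strict Implicit.
Unset Printing Implicit Defensive.

Import Order.TTheory GRing.Theory Num.Theory.

Local Open Scope classical_set_scope.
Local Open Scope ring_scope.
Local Open Scope ereal_scope.

(* Relations are arbitrary sets of pairs: no equivalence axioms are assumed. *)
Definition star (d : measure_display) (T : measurableType d)
    (E : set (T * T)) : set (set T) :=
  [set A | measurable A /\ forall w w' : T, E (w, w') -> (A w <-> A w')].

Definition couplings (d : measure_display) (T : measurableType d)
    (R : realType) (P P' : probability T R) : set (probability (T * T)%type R) :=
  [set Q | forall A : set T, measurable A ->
     pushforward Q fst A = P A /\ pushforward Q snd A = P' A].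

Definition is_max (disp : Order.disp_t) (V : porderType disp)
    (S : set V) (m : V) : Prop := S m /\ ubound S m.

Definition is_min (disp : Order.disp_t) (V : porderType disp)
    (S : set V) (m : V) : Prop := S m /\ lbound S m.

(* The equality max = min, both sides being attained, is stated as the
   existence of a common value m. *)
Definition strong_duality (d : measure_display) (T : measurableType d)
    (R : realType) (E : set (T * T)) (G : set (set T)) : Prop :=
  measurable E /\
  forall P P' : probability T R,
    exists m : \bar R,
      is_max [set `|P A - P' A| | A in G] m /\
      is_min [set 1 - Q E | Q in couplings P P'] m.

(* Main.v *)
Require Import Defs.
From mathcomp Require Import all_boot all_order all_algebra.
From mathcomp Require Import all_classical all_reals all_analysis.

Import Order.TTheory GRing.Theory Num.Theory.

Local Open Scope classical_set_scope.

(** Duality for a pair of Dirac masses at E-related points forces every member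
    of [G] to be [E]-invariant: [G] is contained in [E^*]. The maximizer in [G]
    is therefore admissible for [E^*], and any coupling shows that the sets of
    [E^*] cannot do better than the minimal cost. *)

Lemma le_star_coupling (R : realType) (d : measure_display)
    (T : measurableType d) (E : set (T * T)) (P P' : probability T R)
    (Q : probability (T * T)%type R) (A : set T) :
  measurable E -> couplings P P' Q -> star E A ->
  (`|P A - P' A| <= 1 - Q E)%E.
Proof.
move=> mE cQ [mA invA]; have [PA P'A] := cQ A mA.
have mfA : measurable ((fst : T * T -> T) @^-1` A).
  by rewrite -[X in measurable X]setTI; exact: measurable_fst.
have msA : measurable ((snd : T * T -> T) @^-1` A).
  by rewrite -[X in measurable X]setTI; exact: measurable_snd.
have mCE : measurable (~` E) by exact: measurableC.
have le_add (B C : set (T * T)) : measurable B -> measurable C ->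
    B `&` E `<=` C -> (Q B <= Q C + Q (~` E))%E.
  move=> mB mC BEC; apply: le_trans (measureU2 Q mC mCE).
  apply: le_measure; rewrite ?inE//; first exact: measurableU.
  by move=> z Bz; have [Ez|] := pselect (E z); [left; apply: BEC|right].
have le1 : (P A <= P' A + Q (~` E))%E.
  rewrite -PA -P'A; apply: le_add => // -[x y] [/= Ax Exy].
  by rewrite -(invA x y Exy).
have le2 : (P' A <= P A + Q (~` E))%E.
  rewrite -PA -P'A; apply: le_add => // -[x y] [/= Ay Exy].
  by rewrite (invA x y Exy).
rewrite -probability_setC//; move: le1 le2.
(* All three masses are finite, so the two bounds can be rearranged as real inequalities. *)
have /fineK <- := fin_num_measure P A mA.
have /fineK <- := fin_num_measure P' A mA.
have /fineK <- := fin_num_measure Q _ mCE.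
rewrite -!EFinD !lee_fin => le1 le2.
by rewrite ler_norml lerBlDl le1 andbT lerNl opprB lerBlDl.
Qed.

Lemma dirac_couplings (R : realType) (d : measure_display)
    (T : measurableType d) (x y : T) :
  couplings (dirac x : probability T R) (dirac y : probability T R)
    (dirac (x, y) : probability (T * T)%type R).
Proof. by move=> A mA; split; rewrite /pushforward /= !diracE. Qed.

(** For [E (x, y)], the Dirac mass at [(x, y)] couples those at [x] and [y] with cost 0. The common
    value [m] is at most this cost and bounds the gap on every member of [G]. *)
Lemma strong_duality_sub_star (R : realType) (d : measure_display)
    (T : measurableType d) (E : set (T * T)) (G : set (set T)) :
  G `<=` measurable -> strong_duality R E G -> G `<=` star E.
Proof.
move=> hG [mE dual] A GA; split=> [|x y Exy]; first exact: hG.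
have [m [[_ ubm] [_ lbm]]] :=
  dual (dirac x : probability T R) (dirac y : probability T R).
have : (`|dirac x A - dirac y A| <= 0 :> \bar R)%E.
  apply: (@le_trans _ _ m); first by apply: ubm; exists A.
  apply: lbm; exists (dirac (x, y) : probability (T * T)%type R).
    exact: dirac_couplings.
  by rewrite /= indicE mem_set// -EFinD subrr.
(* Dirac values are 0 or 1, so a zero gap means equal membership of [x] and [y] in [A]. *)
rewrite !diracE -EFinB lee_fin normr_le0 subr_eq0 eqr_nat => xy.
by split=> /mem_set inA; apply: set_mem; move: xy; rewrite inA; case: (_ \in _).
Qed.

Theorem proposition3p15 (R : realType) (d : measure_display)
    (T : measurableType d) (E : set (T * T)) (G : set (set T))
    (hG : G `<=` measurable) (hGT : G [set: T]) :
  strong_duality R E G -> strong_duality R E (star E).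
Proof.
move=> dualG; have [mE dual] := dualG; split=> // P P'.
have [m [[[A GA PAm] _] minm]] := dual P P'.
exists m; split=> //; split.
  by exists A => //; exact: strong_duality_sub_star dualG _ GA.
(* An optimal coupling [Q] turns [m] into [1 - Q E], which bounds every gap over [star E]. *)
have [[Q cQ <-] _] := minm.
by move=> _ [B starB <-]; exact: le_star_coupling.
Qed.
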